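(* Let $G$ be a finite solvable group such that all Sylow subgroups of $G$ have nilpotency class at most $2$. Then $G$ is isomorphic to the multiplicative group of a skew left brace of nilpotent type.
   Context: A skew left brace is a set $B$ with two binary operations $+$ and $\circ$ such that $(B,+)$ and $(B,\circ)$ are groups (neither necessarily abelian), called respectively the additive group and the multiplicative group of $B$, and $a\circ(b+c)=a\circ b-a+a\circ c$ for all $a,b,c\in B$. A skew left brace is of nilpotent type if its additive group $(B,+)$ is nilpotent. *)

(* Defs.v *)
From HB Require Import structures.
From mathcomp Require Import all_boot all_fingroup all_solvable.

Set Implicit Arguments.
Unset Strict Implicit.
Unset Printing Implicit Defensive.

Local Open Scope group_scope.

(* The library group structure on B is the multiplicative group: x * y stands *)
(* for x \circ y. The additive groups of the library are commutative, so the  *)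
(* operations of (B, +) are introduced here.                                  *)
HB.mixin Record isSkewBrace B of monoid.Group B := {
  sbadd : B -> B -> B;
  sbzero : B;
  sbopp : B -> B;
  sbaddA : associative sbadd;
  sbadd0b : left_id sbzero sbadd;
  sbaddNb : left_inverse sbzero sbopp sbadd;
  (* a \circ (b + c) = a \circ b - a + a \circ c *)
  sbmulDr : forall a b c : B,
    a * sbadd b c = sbadd (sbadd (a * b) (sbopp a)) (a * c)
}.

#[short(type="skewBraceType")]
HB.structure Definition SkewBrace := {B of isSkewBrace B & monoid.Group B}.

#[short(type="finSkewBraceType")]
HB.structure Definition FinSkewBrace := {B of SkewBrace B & Finite B}.

(* A copy of B whose library group structure is (B, +). *)
Definition additive_group (B : Type) : Type := B.

HB.instance Definition _ (B : finSkewBraceType) :=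
  Finite.on (additive_group B).
HB.instance Definition _ (B : finSkewBraceType) :=
  Finite_isGroup.Build (additive_group B)
    (@sbaddA B) (@sbadd0b B) (@sbaddNb B).

Definition nilpotent_type (B : finSkewBraceType) : bool :=
  nilpotent [set: additive_group B].

(* Main.v *)
From HB Require Import structures.
From mathcomp Require Import all_boot all_fingroup all_solvable.
Require Import Defs.

(** A skew brace with multiplicative group G is the same thing as a bijection
f from G onto a group A (the additive group) for which
   f (g * l) = f (g * h) * (f g)^-1 * f (g * k)  whenever  f l = f h * f k:
this is the brace axiom transported along f.  A nilpotent A is the direct
product of its Sylow subgroups, so f can be built one prime at a time.  For a
prime p it is enough to have a map from G to a p-group A of order the p-part of
G that satisfies the same identity and whose fibres are left cosets of a Hall
p'-subgroup (brace_map): the product of these maps over all primes has trivial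
fibres, hence is a bijection (has_brace_mapU, brace_of).

For the prime p one may divide by 'O_p^'(G) (has_brace_map_quotient), hence
assume 'O_p^'(G) = 1.  Put V = 'O_p(G); it contains its own centraliser since G
is solvable.  A Sylow p-subgroup P has class at most 2, so P^`(1) centralises V
and thus lies in V: the Sylow p-subgroups of G / V are abelian.  Let K / V be
'O_p^'(G / V), let H be a Hall p'-subgroup of G, Q = H :&: K and N = 'N_G(Q).
The Frattini argument gives G = V * N, and with W = [~: V, Q] coprime action
gives W <| G and G = W * N.  Let R be a Sylow p-subgroup of N.  Then P = W * R
is a Sylow subgroup of G, and W :&: R is central in P: it lies in 'C_W(Q), which
is contained in W^`(1) since W = [~: W, Q], and W^`(1) is central because P has
class at most 2.

The p-group A is the central product of W and R over W :&: R, in which W and R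
commute even though they need not commute in G.  It has the same order as P, and
f sends w * r * h, with h in H, to the product of the images of w and r.  For a
fixed g, the effect of left multiplication by g on these products is, up to the
translation by f g, conjugation on W, and on R it is conjugation followed by the
projection of Q * R on R; both are endomorphisms, and this is the brace identity
(has_brace_map_factor).  The projection makes sense since Q * R is normal in N;
this again uses that the Sylow p-subgroups of G / V are abelian. *)

Set Implicit Arguments.
Unset Strict Implicit.
Unset Printing Implicit Defensive.

Local Open Scope group_scope.

(** * Brace maps and the skew braces they define *)

(** The part of a skew brace on G that is visible at the primes in pi: A plays
the role of the Hall pi-subgroup of the additive group, and f that of the
projection on it.  The last clause is the axiom
a \circ (b + c) = a \circ b - a + a \circ c read in A.  When pi contains all
prime divisors of the order of G, the map f is injective on G, hence a bijection
on A by the equality of orders. *)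
Record brace_map (pi : nat_pred) (gT rT : finGroupType) (G : {group gT})
    (A : {group rT}) (f : gT -> rT) : Prop := BraceMap {
  brace_map_mem : {in G, forall g, f g \in A};
  brace_map_card : #|A| = (#|G|`_pi)%N;
  brace_map_fiber : {in G &, forall g h, f g = f h -> pi^'.-elt (g^-1 * h)};
  brace_mapM : forall g h k l, g \in G -> h \in G -> k \in G -> l \in G ->
    f l = f h * f k -> f (g * l) = f (g * h) * (f g)^-1 * f (g * k)
}.

Definition has_brace_map (pi : nat_pred) (gT : finGroupType) (G : {group gT}) :=
  exists (rT : finGroupType) (A : {group rT}) (f : gT -> rT),
    nilpotent A /\ brace_map pi G A f.

Section BraceOfBijection.

Variables (pi : nat_pred) (gT rT : finGroupType).
Variables (G : {group gT}) (A : {group rT}) (f : gT -> rT).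

(** A copy of G that records f, since the additive structure depends on it. *)
Definition brace_of (fG : brace_map pi G A f) (piG : pi.-group G) : Type :=
  subg_of G.

Variables (fG : brace_map pi G A f) (piG : pi.-group G).
Local Notation B := (brace_of fG piG).

HB.instance Definition _ := FinGroup.on B.

Definition coord (x : B) : rT := f (sgval x).
Definition of_coord (a : rT) : B := odflt (1 : B) [pick x : B | coord x == a].

Lemma coord_inj : injective coord.
Proof.
move=> x y eqxy; apply: val_inj => /=; apply/eqP; rewrite eq_mulVg1.
have := brace_map_fiber fG (valP x) (valP y) eqxy.
have Gxy: (val x)^-1 * val y \in G by rewrite groupM ?groupV ?(valP x, valP y).
move/(pnat_1 (mem_p_elt piG Gxy))/eqP; rewrite order_eq1; exact.
Qed.

Lemma codom_coord : coord @: [set: B] = A.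
Proof.
have oB: #|[set: B]| = #|G| by exact: esym (card_isog (isog_subg G)).
apply/eqP; rewrite eqEcard (card_imset _ coord_inj) oB (brace_map_card fG).
rewrite part_pnat_id // leqnn andbT.
by apply/subsetP=> _ /imsetP[x _ ->]; apply: brace_map_mem fG _ (valP x).
Qed.

Lemma of_coordK : {in A, cancel of_coord coord}.
Proof.
move=> a; rewrite -codom_coord /of_coord => /imsetP[x _ ->].
by case: pickP => [y /eqP // | /(_ x)]; rewrite eqxx.
Qed.

Lemma coord_mem x : coord x \in A.
Proof. exact: brace_map_mem fG _ (valP x). Qed.

Definition brace_add (x y : B) := of_coord (coord x * coord y).
Definition brace_zero := of_coord 1.
Definition brace_opp (x : B) := of_coord (coord x)^-1.

Lemma coordD x y : coord (brace_add x y) = coord x * coord y.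
Proof. by rewrite of_coordK // groupM ?coord_mem. Qed.

Lemma coord0 : coord brace_zero = 1.
Proof. by rewrite of_coordK. Qed.

Lemma coordN x : coord (brace_opp x) = (coord x)^-1.
Proof. by rewrite of_coordK // groupV coord_mem. Qed.

Lemma brace_addA : associative brace_add.
Proof. by move=> x y z; apply: coord_inj; rewrite !coordD mulgA. Qed.

Lemma brace_add0 : left_id brace_zero brace_add.
Proof. by move=> x; apply: coord_inj; rewrite coordD coord0 mul1g. Qed.

Lemma brace_addN : left_inverse brace_zero brace_opp brace_add.
Proof. by move=> x; apply: coord_inj; rewrite coordD coordN coord0 mulVg. Qed.

Lemma brace_mulDr (a b c : B) :
  a * brace_add b c = brace_add (brace_add (a * b) (brace_opp a)) (a * c).
Proof.
apply: coord_inj; rewrite !coordD coordN.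
apply: (brace_mapM fG); try exact: (valP (_ : B)).
exact: coordD.
Qed.

HB.instance Definition _ :=
  isSkewBrace.Build B brace_addA brace_add0 brace_addN brace_mulDr.

Lemma brace_of_nilpotent : nilpotent A -> nilpotent_type B.
Proof.
move=> nilA; pose h (x : additive_group B) : rT := coord x.
have hM : {in [set: additive_group B] &, {morph h : x y / x * y}}.
  by move=> x y _ _; apply: coordD.
rewrite /nilpotent_type -(@injm_nil _ _ _ (Morphism hM)) //.
  apply: nilpotentS nilA; apply/subsetP=> _ /morphimP[x _ _ ->].
  exact: coord_mem.
by apply/injmP=> x y _ _; apply: coord_inj.
Qed.

Lemma isog_brace_of : G \isog [set: B].
Proof. exact: isog_subg. Qed.

End BraceOfBijection.

Lemma has_brace_map0 (gT : finGroupType) (G : {group gT}) :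
  has_brace_map pred0 G.
Proof.
exists gT, 1%G, (fun=> 1); split; first exact: nilpotent1.
split=> [g _ | | g h _ _ _ | g h k l _ _ _ _ _]; rewrite ?inE ?mulg1 ?mulgV //.
  by rewrite cards1 part_p'nat //; apply/pnatP.
by apply/pgroupP.
Qed.

(** The product of two brace maps satisfies the brace identity coordinatewise;
if it identifies g and h, the order of g^-1 * h is prime to both sets. *)
Lemma has_brace_mapU (pi rho : nat_pred) (gT : finGroupType) (G : {group gT}) :
    {in pi, forall p, p \notin rho} ->
    has_brace_map pi G -> has_brace_map rho G ->
  has_brace_map [predU pi & rho] G.
Proof.
move=> tiPR [rT1 [A1 [f1 [nil1 f1G]]]] [rT2 [A2 [f2 [nil2 f2G]]]].
exists (rT1 * rT2)%type, (setX A1 A2)%G, (fun g => (f1 g, f2 g)); split.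
  rewrite (dprod_nil (setX_dprod A1 A2)) -morphim_pairg1 -morphim_pair1g.
  by rewrite !injm_nil ?subsetT ?injm_pairg1 ?injm_pair1g ?nil1.
split=> [g Gg | | g h Gg Gh [eq1 eq2] | g h k l Gg Gh Gk Gl [eq1 eq2]].
- by rewrite inE (brace_map_mem f1G) ?(brace_map_mem f2G).
- rewrite cardsX (brace_map_card f1G) (brace_map_card f2G).
  rewrite -[RHS](partnC pi) ?part_gt0 // -!partnI.
  congr (_ * _)%N; apply: eq_partn => q; rewrite !inE /=.
    by case: (q \in pi) => //=; rewrite andbF.
  case: (boolP (q \in pi)) => [/tiPR/negPf-> // | _] /=; exact/esym/andbT.
- have/pgroupP pi'x := brace_map_fiber f1G Gg Gh eq1.
  have/pgroupP rho'x := brace_map_fiber f2G Gg Gh eq2.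
  apply/pgroupP=> q q_pr qx; rewrite !inE negb_or.
  by have:= pi'x q q_pr qx; have:= rho'x q q_pr qx; rewrite !inE => -> ->.
congr (_, _); first exact: (brace_mapM f1G _ Gh Gk Gl).
exact: (brace_mapM f2G _ Gh Gk Gl).
Qed.

(** Composing with the projection on G / M enlarges the fibres by M only, which
is harmless at the primes in pi. *)
Lemma has_brace_map_quotient (pi : nat_pred) (gT : finGroupType)
    (G M : {group gT}) :
    M <| G -> pi^'.-group M -> has_brace_map pi (G / M)%G ->
  has_brace_map pi G.
Proof.
move=> nsMG pi'M [rT [A [f [nilA fG]]]]; have nMG := normal_norm nsMG.
exists rT, A, (f \o coset M); split=> //.
split=> [g Gg | | g h Gg Gh /= eqf | g h k l Gg Gh Gk Gl /= eqf].
- by apply: brace_map_mem fG _ _; apply: mem_quotient.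
- rewrite (brace_map_card fG) card_quotient // -(Lagrange (normal_sub nsMG)).
  by rewrite partnM ?cardG_gt0 // (part_p'nat pi'M) mul1n.
- have:= brace_map_fiber fG (mem_quotient M Gg) (mem_quotient M Gh) eqf.
  have Nx: g^-1 * h \in 'N(M) by rewrite (subsetP nMG) // groupM ?groupV.
  rewrite -morphV ?(subsetP nMG) // -morphM ?groupV ?(subsetP nMG) //=.
  rewrite /p_elt /order -quotient_cycle // => pi'x.
  change (pi^'.-group <[g^-1 * h]>).
  by rewrite -(pquotient_pgroup pi'M) // cycle_subG.
rewrite !morphM ?(subsetP nMG) //.
by apply: (brace_mapM fG); rewrite ?mem_quotient.
Qed.

(** * Brace maps from a factorisation W * R * H *)

(** The central product of W and R amalgamating W :&: R, given as a new group
law carried by the set W * R: it agrees with the old one on W, on R and on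
products w * r, but makes W and R commute.  It is the quotient of the direct
product by the antidiagonal Z of pairs (d, d^-1), and Z is central because
W :&: R is central in both factors. *)
Lemma central_product_exists (gT : finGroupType) (W R : {group gT}) :
    R \subset 'N(W) -> W :&: R \subset 'C(W) -> W :&: R \subset 'C(R) ->
  exists (rT : finGroupType) (A : {group rT}) (f : gT -> rT),
  [/\ {in W & R, forall w r, {in W & R, forall w' r',
         f (w * r) * f (w' * r') = f (w * w' * (r * r'))}},
      {in W * R &, injective f} & f @: (W * R) = A].
Proof.
move=> nWR cW cR; pose D := (W :&: R)%G.
pose h (d : gT) : gT * gT := (d, d^-1).
have cDD x y : x \in D -> y \in D -> x * y = y * x.
  move=> Dx; rewrite inE => /andP[Wy _].
  by apply: (centP (subsetP cW x Dx)).
have hM : {in D &, {morph h : x y / x * y}}.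
  by move=> x y Dx Dy; congr (_, _); rewrite /= cDD // invMg.
pose Z := (Morphism hM @* D)%G.
have nZ : setX W R \subset 'N(Z).
  apply: cents_norm; apply/subsetP=> [[w r]]; rewrite inE /= => /andP[Ww Rr].
  apply/centP=> _ /morphimP[d Dd _ ->]; congr (_, _) => /=.
    by have /centP/(_ w Ww) := subsetP cW d Dd.
  by have /centP/(_ r Rr) := subsetP cR d^-1 (groupVr Dd).
pose f x := coset Z (divgr W R x, remgr W R x).
have fE : {in W & R, forall w r, f (w * r) = coset Z (w, r)}.
  move=> w r Ww Rr; set x := w * r.
  have WRx: x \in W * R by apply: mem_mulg.
  (* The decomposition of x chosen by divgr and remgr differs from (w, r) by *)
  (* an element d of W :&: R, which Z absorbs.                               *)
  have [Wd Rr'] := (mem_divgr WRx, mem_remgr WRx).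
  have Ex := divgr_eq W R x.
  have Ed : w^-1 * divgr W R x = r * (remgr W R x)^-1.
    by apply: (mulgI w); rewrite mulKVg mulgA -/x {2}Ex mulgK.
  set d := w^-1 * _ in Ed.
  have Dd : d \in D.
    by apply/setIP; split; [|rewrite Ed]; rewrite groupM ?groupV.
  have Zd : h d \in Z by apply: (mem_morphim (Morphism hM)).
  have E1 : divgr W R x = w * d by rewrite mulKVg.
  have E2 : remgr W R x = r * d^-1.
    have /centP/(_ r Rr) := subsetP cR _ (groupVr Dd); rewrite /commute => <-.
    by rewrite Ed invMg invgK mulgKV.
  by rewrite /f E1 E2 -[RHS](coset_kerr _ Zd).
have inX w r : w \in W -> r \in R -> (w, r) \in setX W R.
  by rewrite inE /= => ->.
exists (coset_of Z), (setX W R / Z)%G, f; split.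
- move=> w r Ww Rr w' r' Ww' Rr'.
  rewrite !fE ?groupM // -morphM //; apply: (subsetP nZ); exact: inX.
- move=> _ _ /mulsgP[w r Ww Rr ->] /mulsgP[w' r' Ww' Rr' ->].
  rewrite !fE // => /kercoset_rcoset[]; try exact: (subsetP nZ _ (inX _ _ _ _)).
  move=> _ /morphimP[d _ Dd ->] [-> ->].
  have /centP/(_ w' Ww') Ed := subsetP cW d Dd.
  by rewrite Ed mulgA mulgK.
apply/setP=> y; apply/imsetP/morphimP.
  case=> _ /mulsgP[w r Ww Rr ->] ->; rewrite fE //.
  by exists (w, r); rewrite ?(subsetP nZ) ?inX.
case=> [[w r]] _; rewrite inE /= => /andP[Ww Rr] ->.
by exists (w * r); rewrite ?mem_mulg ?fE.
Qed.

(** Writing g = w0 * r0 * t with w0 in W, r0 in R and t in H, multiplication by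
g turns w * r * y into w0 * alpha w * (r0 * beta r) up to a factor in H on the
right, where alpha is conjugation by (r0 * t)^-1 and beta is conjugation by t^-1
followed by the projection of Q * R on R along Q.  As alpha and beta are
multiplicative and the images of W and R commute in the central product, the
brace identity follows. *)
Lemma has_brace_map_factor (p : nat) (gT : finGroupType)
    (G P H W R Q : {group gT}) :
    p.-group P -> p^'.-group H -> P * H = G -> W * R = P -> W <| G ->
    W :&: R \subset 'C(W) -> W :&: R \subset 'C(R) ->
    Q \subset H -> R \subset 'N(Q) -> H \subset 'N(Q * R) ->
  has_brace_map p G.
Proof.
move=> pP p'H defG defP /andP[sWG nWG] cW cR sQH nQR nQRH.
have [hallP _] := coprime_mulpG_Hall defG pP p'H.
have tiPH : P :&: H = 1 := coprime_TIg (pnat_coprime pP p'H).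
have sPG : P \subset G by rewrite -defG mulG_subl.
have sHG : H \subset G by rewrite -defG mulG_subr.
have sRP : R \subset P by rewrite -defP mulG_subr.
have sRG := subset_trans sRP sPG.
have tiQR : Q :&: R = 1.
  by apply/trivgP; rewrite -tiPH setIC setISS.
have nWR := subset_trans sRG nWG.
have [rT [A [f [fM f_inj imf]]]] := central_product_exists nWR cW cR.
have compl : R \in [complements to Q in (Q <*> R)%G].
  by apply/complP; rewrite /= norm_joinEr.
have nsQ : Q <| Q <*> R by rewrite normalYl.
have fW w r : w \in W -> r \in R -> f (w * r) = f w * f r.
  move=> Ww Rr; have:= fM w 1 Ww (group1 R) 1 r (group1 W) Rr.
  by rewrite !mul1g !mulg1.
have fMW : {in W &, {morph f : x y / x * y}}.
  move=> x y Wx Wy; have:= fM x 1 Wx (group1 R) y 1 Wy (group1 R).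
  by rewrite !mulg1.
have fMR : {in R &, {morph f : x y / x * y}}.
  move=> x y Rx Ry; have:= fM 1 x (group1 W) Rx 1 y (group1 W) Ry.
  by rewrite !mul1g.
have fC w r : w \in W -> r \in R -> f w * f r = f r * f w.
  move=> Ww Rr; rewrite -fW //.
  by have:= fM 1 r (group1 W) Rr w 1 Ww (group1 R); rewrite !mul1g !mulg1.
exists rT, A, (fun g => f (divgr P H g)).
have oA : #|A| = #|P| by rewrite -imf card_in_imset defP // -defP.
split; first by apply: (@pgroup_nil _ p); rewrite /pgroup oA.
have decG g : g \in G ->
  exists w r h, [/\ w \in W, r \in R, h \in H & g = w * r * h].
  rewrite -defG => /mulsgP[x h]; rewrite -defP => /mulsgP[w r Ww Rr ->] Hh ->.
  by exists w, r, h.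
have prE w r h : w \in W -> r \in R -> h \in H ->
    divgr P H (w * r * h) = w * r.
  by move=> Ww Rr Hh; rewrite divgrMid // -defP mem_mulg.
split=> [g | | g h Gg Gh | g h k l Gg Gh Gk Gl].
- by rewrite -imf -defG => PHg; rewrite imset_f // defP mem_divgr.
- by rewrite oA (card_Hall hallP).
- move: Gg Gh; rewrite -defG => PHg PHh eqf.
  have{eqf} eqd : divgr P H g = divgr P H h.
    by apply: f_inj eqf; rewrite defP mem_divgr.
  apply: mem_p_elt p'H _.
  rewrite (divgr_eq P H g) (divgr_eq P H h) eqd invMg -mulgA mulKg.
  by rewrite groupM ?groupV // mem_remgr.
have [w0 [r0 [t [Ww0 Rr0 Ht ->]]]] := decG g Gg.
pose alpha w := w ^ (r0 * t)^-1.
pose beta r := remgr Q R (r ^ t^-1).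
have QRJ r : r \in R -> r ^ t^-1 \in Q * R.
  move=> Rr; rewrite memJ_norm ?(subsetP nQRH) ?groupV //.
  by rewrite -[r]mul1g mem_mulg.
have Wa w : w \in W -> alpha w \in W.
  move=> Ww; rewrite memJ_norm // (subsetP nWG) // groupV groupM //.
    exact: (subsetP sRG).
  exact: (subsetP sHG).
have Rb r : r \in R -> beta r \in R by move=> /QRJ/mem_remgr.
have aM : {in W &, {morph alpha : x y / x * y}}.
  by move=> x y _ _; apply: conjMg.
have bM : {in R &, {morph beta : x y / x * y}}.
  move=> x y Rx Ry; rewrite /beta conjMg (remgrM compl) //=;
    by rewrite norm_joinEr ?QRJ.
have key w r y : w \in W -> r \in R -> y \in H ->
    f (divgr P H (w0 * r0 * t * (w * r * y))) =
      f w0 * f (alpha w) * (f r0 * f (beta r)).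
  move=> Ww Rr Hy; pose q := divgr Q R (r ^ t^-1).
  have Qq : q \in Q by apply: mem_divgr (QRJ r Rr).
  (* The component in Q is moved to the right of beta r, where H absorbs it. *)
  have Eb : beta r * q ^ beta r = t * r * t^-1.
    by rewrite -conjgC -divgr_eq conjgE invgK mulgA.
  have Hq : q ^ beta r \in H.
    by rewrite (subsetP sQH) // memJ_norm // (subsetP nQR) ?Rb.
  have Ht' : q ^ beta r * t * y \in H by rewrite (groupM (groupM Hq Ht)).
  have Wa1 := groupM Ww0 (Wa w Ww); have Rb1 := groupM Rr0 (Rb r Rr).
  rewrite -fMW ?Wa // -fMR ?Rb // -fW // -[in RHS](prE _ _ _ _ _ Ht') //.
  congr (f (divgr P H _)).
  rewrite -[RHS]mulgA.
  have -> : r0 * beta r * (q ^ beta r * t * y) = r0 * (t * r * t^-1) * t * y.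
    by rewrite -Eb !mulgA.
  by rewrite /alpha conjgE invgK invMg !mulgA !mulgKV.
have [w1 [r1 [t1 [Ww1 Rr1 Ht1 ->]]]] := decG h Gh.
have [w2 [r2 [t2 [Ww2 Rr2 Ht2 ->]]]] := decG k Gk.
have [w3 [r3 [t3 [Ww3 Rr3 Ht3 ->]]]] := decG l Gl.
rewrite (prE w1) // (prE w2) // (prE w3) // fM //.
move/f_inj=> ->; rewrite ?mem_mulg ?groupM //.
rewrite !key ?groupM // (prE w0) // (aM w1) // (bM r1) //.
rewrite (fMW (alpha w1)) ?Wa // (fMR (beta r1)) ?Rb // (fW w0) // invMg.
(* On the right-hand side f (alpha w2) has to pass the conjugate of *)
(* f (beta r1) by f r0.                                             *)
have Ca r : r \in R -> commute (f (alpha w2)) (f r).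
  by move=> Rr; apply: fC; rewrite ?Wa.
have := commuteM (commuteM (Ca _ Rr0) (Ca _ (Rb _ Rr1))) (commuteV (Ca _ Rr0)).
rewrite /commute !mulgA => Ec.
transitivity (f w0 * f (alpha w1) *
    (f r0 * f (beta r1) * (f r0)^-1 * f (alpha w2)) * f r0 * f (beta r2)).
  by rewrite -Ec !mulgA mulgKV.
by rewrite !mulgA mulgKV.
Qed.

(** * Solvable groups and coprime action *)

(** Otherwise take K <| G such that K / 'F(G) is a nontrivial abelian subgroup
of the image of C = 'C_G('F(G)).  The derived subgroup of C :&: K lies in 'F(G),
which C centralises, so C :&: K is nilpotent of class at most 2 and lies in
'F(G); then so does K. *)
Lemma cent_sub_Fitting (gT : finGroupType) (G : {group gT}) :
  solvable G -> 'C_G('F(G)) \subset 'F(G).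
Proof.
move=> solG; set F := 'F(G)%G; set C := 'C_G(F)%G.
have nsFG : F <| G := Fitting_normal G.
have nFG := normal_norm nsFG.
have nsCG : C <| G.
  by rewrite /normal subsetIl normsI ?normG ?norms_cent.
have sCG := normal_sub nsCG.
apply/negPn/negP=> notsCF.
have ntC : C / F != 1.
  by rewrite -subG1 quotient_sub1 // (subset_trans sCG).
have [Kb [sKC nsKb ntK /is_abelemP[p _ abK]]] :=
  solvable_norm_abelem (quotient_sol F (solvableS sCG solG))
    (quotient_normal F nsCG) ntC.
have [K defK sFK nsKG] := inv_quotientN nsFG nsKb.
have sKG := normal_sub nsKG.
have nFK := subset_trans sKG nFG.
have abKF : abelian (K / F) by rewrite -defK (abelem_abelian abK).
pose D := (C :&: K)%G.
have sDF : D^`(1) \subset F.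
  apply: subset_trans (dergS 1 (subsetIr C K)) _.
  exact: der1_min.
have cDF : F \subset 'C(D).
  by rewrite centsC (subset_trans (subsetIl C K)) // subsetIr.
have nilD : nilpotent D.
  rewrite -quotient_center_nil abelian_nil // sub_der1_abelian //.
  by rewrite subsetI der_sub (subset_trans sDF).
have sDF' : D \subset F by rewrite Fitting_max // normalI.
case/negP: ntK; rewrite defK -subG1 quotient_sub1 //.
rewrite -[F : {set gT}](mulGSid sDF') (group_modl _ sFK) subsetI subxx andbT.
by rewrite -quotientSK // -defK.
Qed.

(** A acts trivially on G / [~: G, A], and under coprime action fixed points
lift from a quotient. *)
Lemma coprime_cent_prod (gT : finGroupType) (A G : {group gT}) :
    A \subset 'N(G) -> coprime #|G| #|A| -> solvable G ->
  [~: G, A] * 'C_G(A) = G.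
Proof.
move=> nGA coGA solG; set W := [~: G, A]%G.
have sWG : W \subset G by rewrite commg_subl.
have nWG : G \subset 'N(W) := commg_norml G A.
have nWA : A \subset 'N(W) := commg_normr A G.
have nWC : 'C_G(A) \subset 'N(W) by rewrite subIset ?nWG.
apply/eqP; rewrite eqEsubset mul_subG ?subsetIl //=.
rewrite -quotientSK // coprime_quotient_cent // subsetI subxx.
by rewrite quotient_cents2r.
Qed.

(** In G = [~: G, A] * 'C_G(A) the second factor adds nothing to [~: G, A]. *)
Lemma coprime_commGid (gT : finGroupType) (A G : {group gT}) :
    A \subset 'N(G) -> coprime #|G| #|A| -> solvable G ->
  [~: [~: G, A], A] = [~: G, A].
Proof.
move=> nGA coGA solG.
rewrite -{2}(coprime_cent_prod nGA coGA solG) commMG.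
  by rewrite (commG1P (subsetIr _ _)) mulg1.
rewrite normsR // ?(subset_trans (subsetIl _ _) (commg_norml _ _)) //.
by rewrite cents_norm // subsetIr.
Qed.

(** On the abelian group W / W^`(1) = [~: W / W^`(1), A] the group A has no
nontrivial fixed points. *)
Lemma coprime_cent_comm_sub_der1 (gT : finGroupType) (A W : {group gT}) :
    A \subset 'N(W) -> coprime #|W| #|A| -> [~: W, A] = W ->
  'C_W(A) \subset W^`(1).
Proof.
move=> nWA coWA defW; have nDW : W \subset 'N(W^`(1)) := der_norm 1 W.
have nDA : A \subset 'N(W^`(1)) by rewrite gFnorm_trans.
rewrite -quotient_sub1; last by rewrite subIset ?nDW.
rewrite -(@coprime_abel_cent_TI _ (A / W^`(1)) (W / W^`(1))).
- rewrite -quotientR // defW; exact: quotient_subcent.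
- exact: quotient_norms.
- exact: coprime_morph.
exact: sub_der1_abelian.
Qed.

(** Solvable groups with abelian Sylow p-subgroups have p-length at most 1.
In the quotient by 'O_p^'(G) the p-core contains its centraliser, hence also the
abelian Sylow subgroup, which contains the p-core. *)
Lemma abelian_Sylow_pcore_mul_normal (p : nat) (gT : finGroupType)
    (G P : {group gT}) :
  solvable G -> p.-Sylow(G) P -> abelian P -> 'O_p^'(G) * P <| G.
Proof.
move=> solG sylP abP; set M := 'O_p^'(G)%G.
have nsMG : M <| G := pcore_normal _ _.
have sPG := pHall_sub sylP; have nMP := subset_trans sPG (normal_norm nsMG).
have sylPb : p.-Sylow(G / M) (P / M) by apply: quotient_pHall.
have O1 : 'O_p^'(G / M) = 1 := trivg_pcore_quotient _ _.
have sFP : 'O_p(G / M) \subset P / M := pcore_sub_Hall sylPb.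
have sPF : P / M \subset 'O_p(G / M).
  rewrite -(Fitting_eq_pcore O1); apply: subset_trans _ (cent_sub_Fitting _).
    rewrite subsetI (pHall_sub sylPb) (Fitting_eq_pcore O1) centsC.
    exact: subset_trans sFP (quotient_abelian _ abP).
  exact: quotient_sol.
rewrite -quotientK // -[X in _ <| X](quotientGK nsMG) cosetpre_normal.
have -> : P / M = 'O_p(G / M) by apply/eqP; rewrite eqEsubset sPF.
exact: pcore_normal.
Qed.

(** * The brace map at one prime, and the theorem *)

(** The choice of W, R, Q and H explained at the top: G = W * R * H with W :&: R
central in the Sylow subgroup W * R and with Q * R normalised by H. *)
Lemma has_brace_map_pcore1 (p : nat) (gT : finGroupType) (G : {group gT}) :
    solvable G -> 'O_p^'(G) = 1 ->
    (forall P : {group gT}, p.-Sylow(G) P -> nil_class P <= 2) ->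
  has_brace_map p G.
Proof.
move=> solG O1 sylG.
set V := 'O_p(G)%G; have nsVG : V <| G := pcore_normal _ _.
have [sVG nVG] := andP nsVG.
have pV : p.-group V := pcore_pgroup _ _.
have cV : 'C_G(V) \subset V.
  by have := cent_sub_Fitting solG; rewrite (Fitting_eq_pcore O1).
(* K / V is the largest normal p'-subgroup of G / V, and K = V * Q. *)
set K := (coset V @*^-1 'O_p^'(G / V))%G.
have nsKG : K <| G.
  by rewrite -[X in _ <| X](quotientGK nsVG) cosetpre_normal pcore_normal.
have sKG := normal_sub nsKG.
have defKV : K / V = 'O_p^'(G / V) by rewrite cosetpreK.
have [H hallH] := Hall_exists p^' solG.
have sHG := pHall_sub hallH; have p'H := pHall_pgroup hallH.
set Q := (H :&: K)%G.
have hallQ : p^'.-Hall(K) Q := Hall_setI_normal nsKG hallH.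
have sQH : Q \subset H := subsetIl _ _.
have sQG := subset_trans sQH sHG.
have p'Q : p^'.-group Q := pgroupS sQH p'H.
have nVQ := subset_trans sQG nVG.
have defK : V * Q = K.
  apply/eqP; rewrite eqEsubset mul_subG ?subsetIr //=; last first.
    by rewrite sub_cosetpre.
  rewrite -quotientSK ?(subset_trans sKG) //.
  have hallQV := quotient_pHall nVQ hallQ.
  have p'KV : p^'.-group (K / V) by rewrite defKV pcore_pgroup.
  by rewrite (pHall_id hallQV p'KV).
set N := 'N_G(Q)%G.
have sNG : N \subset G := subsetIl _ _.
have sQN : Q \subset N by rewrite subsetI sQG normG.
have sHN : H \subset N.
  by rewrite subsetI sHG normsI ?normG // (subset_trans sHG) ?normal_norm.
have defG : V * N = G.
  rewrite -[RHS](Hall_Frattini_arg (solvableS sKG solG) nsKG hallQ) -defK.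
  by rewrite -mulgA (mulSGid sQN).
have coVQ : coprime #|V| #|Q| := pnat_coprime pV p'Q.
have solV := solvableS sVG solG.
set W := [~: V, Q]%G.
have sWV : W \subset V by rewrite commg_subl.
have sWG := subset_trans sWV sVG.
have pW := pgroupS sWV pV.
have nsWG : W <| G.
  rewrite /normal sWG -defG mul_subG ?commg_norml //.
  by rewrite normsR ?subsetIr // (subset_trans sNG).
have nWG := normal_norm nsWG.
have defGW : W * N = G.
  rewrite -defG -(coprime_cent_prod nVQ coVQ solV) -mulgA.
  congr (_ * _); apply/esym/mulSGid.
  by rewrite subsetI (subset_trans (subsetIl _ _)) // cents_norm ?subsetIr.
have [R sylR] := Sylow_exists p N.
have sRN := pHall_sub sylR; have sRG := subset_trans sRN sNG.
have pR := pHall_pgroup sylR.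
have nQR : R \subset 'N(Q) := subset_trans sRN (subsetIr _ _).
have nWR := subset_trans sRG nWG.
set P := (W <*> R)%G.
have defP : W * R = P by rewrite /= norm_joinEr.
have pP : p.-group P by rewrite -defP pgroupM pW.
have sylP : p.-Sylow(G) P.
  rewrite -(pquotient_pHall pW) //; last by rewrite normalYl.
  have eqGN : G / W = N / W by rewrite -[in LHS]defGW quotientMidl.
  rewrite /= quotientYidl // eqGN.
  by apply: quotient_pHall.
have cP : P^`(1) \subset 'Z(P) by rewrite -nil_class2 sylG.
have sVP : V \subset P := pcore_sub_Hall sylP.
have sPG := pHall_sub sylP.
have nVP := subset_trans sPG nVG.
have abPV : abelian (P / V).
  apply: sub_der1_abelian; apply: subset_trans cV.
  by apply: subset_trans cP _; rewrite setISS ?centS.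
(* P * Q = P * K is the preimage of a normal subgroup of G / V. *)
have nsPQ : P * Q <| G.
  have sylPV := quotient_pHall nVP sylP.
  have := abelian_Sylow_pcore_mul_normal (quotient_sol V solG) sylPV abPV.
  rewrite -defKV -quotientMl ?(subset_trans sKG) //.
  rewrite -cosetpre_normal quotientGK // quotientK; last first.
    by rewrite mul_subG ?(subset_trans sKG).
  rewrite -(normC (subset_trans sPG (normal_norm nsKG))) -defK !mulgA.
  by rewrite (mulSGid sVP) (mulGSid sVP).
(* By the modular law N meets P * Q = W * R * Q in (W :&: N) * R * Q, and *)
(* the normal p-subgroup W :&: N of N lies in its Sylow subgroup R.       *)
have pWN : p.-group (W :&: N) := pgroupS (subsetIl _ _) pW.
have sWNR : W :&: N \subset R.
  rewrite (normal_sub_max_pgroup (Hall_max sylR)) // /normal subsetIr.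
  by rewrite normsI ?normG // (subset_trans sNG).
have nHQR : H \subset 'N(Q * R).
  have -> : Q * R = (P * Q) :&: N.
    rewrite setIC -defP -mulgA -group_modr ?mul_subG //.
    by rewrite mulgA setIC (mulSGid sWNR) (normC nQR).
  apply: normsI; last by rewrite (subset_trans sHN) ?normG.
  by rewrite (subset_trans sHG) ?normal_norm.
(* Q normalises W and R normalises Q, so [~: W :&: R, Q] lies in W :&: Q = 1 *)
(* and W :&: R in 'C_W(Q).                                                   *)
have coWQ : coprime #|W| #|Q| := coprimeSg sWV coVQ.
have cDP : W :&: R \subset 'C(P).
  apply: subset_trans (_ : 'Z(P) \subset _); last exact: subsetIr.
  apply: subset_trans cP; apply: subset_trans (dergS 1 (joing_subl W R)).
  have nWQ := subset_trans sQG nWG.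
  apply: subset_trans (coprime_cent_comm_sub_der1 nWQ coWQ _); last first.
    exact: coprime_commGid.
  rewrite subsetI subsetIl /=; apply/commG1P/trivgP.
  rewrite -(coprime_TIg coWQ) subsetI.
  rewrite (subset_trans (commSg _ (subsetIl _ _))) ?commg_subl //=.
  by rewrite (subset_trans (commSg _ (subsetIr _ _))) ?commg_subr.
have /complP[_ defPH] : H \in [complements to P in G].
  by rewrite (compl_pHall _ sylP).
apply: (has_brace_map_factor pP p'H defPH defP nsWG _ _ sQH nQR nHQR).
  by rewrite (subset_trans cDP) ?centS ?joing_subl.
by rewrite (subset_trans cDP) ?centS ?joing_subr.
Qed.

(** The Sylow p-subgroups of G / 'O_p^'(G) are images of those of G, so the
bound on their class is inherited. *)
Lemma has_brace_map_prime (p : nat) (gT : finGroupType) (G : {group gT}) :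
    solvable G ->
    (forall P : {group gT}, p.-Sylow(G) P -> nil_class P <= 2) ->
  has_brace_map p G.
Proof.
move=> solG sylG; have nsMG : 'O_p^'(G) <| G := pcore_normal _ _.
apply: (has_brace_map_quotient nsMG (pcore_pgroup _ _)).
apply: has_brace_map_pcore1; first exact: quotient_sol.
  exact: trivg_pcore_quotient.
move=> Pb sylPb; have [P sylP] := Sylow_exists p G.
have nMP := subset_trans (pHall_sub sylP) (normal_norm nsMG).
have [x Gx ->] := Sylow_trans (quotient_pHall nMP sylP) sylPb.
rewrite -(isog_nil_class (conj_isog _ x)).
apply: leq_trans (nil_class_morphim _ _) (sylG P sylP).
exact: pgroup_nil (pHall_pgroup sylP).
Qed.

Lemma has_brace_map_primes (s : seq nat) (gT : finGroupType) (G : {group gT}) :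
    solvable G -> uniq s ->
    (forall p (P : {group gT}), p \in s -> p.-Sylow(G) P -> nil_class P <= 2) ->
  exists2 pi : nat_pred, pi =i s & has_brace_map pi G.
Proof.
move=> solG; elim: s => [|p s IHs] /= => [_ _ | /andP[s'p uniq_s] sylG].
  by exists pred0 => //; apply: has_brace_map0.
have [q P s_q | pi def_pi pi_map] := IHs uniq_s.
  by apply: sylG; rewrite inE s_q orbT.
exists [predU (p : nat_pred) & pi] => [q |]; first by rewrite !inE def_pi.
apply: has_brace_mapU pi_map => [q /eqP-> |]; first by rewrite def_pi.
by apply: has_brace_map_prime => // P; apply: sylG; rewrite inE eqxx.
Qed.

Theorem theorem3p5 (gT : finGroupType) (G : {group gT})
  (solG : solvable G)
  (sylG : forall (p : nat) (P : {group gT}),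
     prime p -> (p.-Sylow(G) P)%g -> nil_class P <= 2) :
  exists B : finSkewBraceType, nilpotent_type B /\ (G \isog [set: B])%g.
Proof.
have [| p P | pi def_pi [rT [A [f [nilA fG]]]]] :=
  @has_brace_map_primes (primes #|G|) _ G solG.
- exact: primes_uniq.
- by rewrite mem_primes => /andP[p_pr _]; apply: sylG.
have piG : pi.-group G.
  by apply: sub_pgroup (pgroup_pi G) => q; rewrite def_pi.
exists (brace_of fG piG); split; first exact: brace_of_nilpotent.
exact: isog_brace_of.
Qed.
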